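(* The formula with reversal $\phi_2 = xy_1y_2x\cdot y_1^R\cdot y_2^R$ is $5$-avoidable.
   Context: Let $\Sigma$ be a set of variables and $\Sigma^R=\{x^R:x\in\Sigma\}$. For words, $(a_1\cdots a_n)^R=a_n\cdots a_1$. A morphism $h$ on $(\Sigma\cup\Sigma^R)^*$ respects reversal if $h(x^R)=h(x)^R$. The formula $\phi_2$ consists of the fragments $xy_1y_2x$, $y_1^R$, $y_2^R$; it occurs in a word $u$ if there is a non-erasing morphism $h$ respecting reversal such that the images of all three fragments are factors of $u$; otherwise $u$ avoids it. A formula is $k$-avoidable if infinitely many words over a $k$-letter alphabet avoid it. *)

(* Defs.v *)
From Stdlib Require List.
From mathcomp Require Import all_boot.
From mathcomp Require Import classical_sets cardinality.
Set Implicit Arguments.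
Unset Strict Implicit.
Unset Printing Implicit Defensive.

(* The alphabet Sigma \cup Sigma^R is the disjoint sum of two copies of V:
   [inl x] is the letter x and [inr x] is the letter x^R. *)
Definition rletter (V : Type) : Type := (V + V)%type.

(* A formula with reversal is given by the list of its fragments. *)
Definition rformula (V : Type) : Type := seq (seq (rletter V)).

Definition word_morphism (B A : Type) (h : seq B -> seq A) : Prop :=
  h [::] = [::] /\ forall u v, h (u ++ v) = h u ++ h v.

Definition nonerasing (B A : Type) (h : seq B -> seq A) : Prop :=
  forall b, h [:: b] <> [::].

Definition respects_reversal (V A : Type) (h : seq (rletter V) -> seq A) :
  Prop := forall x, h [:: inr x] = rev (h [:: inl x]).

Definition occurs (V : Type) (A : eqType) (phi : rformula V) (u : seq A) :
  Prop :=
  exists h : seq (rletter V) -> seq A,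
    [/\ word_morphism h, nonerasing h, respects_reversal h
      & forall f, List.In f phi -> infix (h f) u].

Definition avoids (V : Type) (A : eqType) (u : seq A) (phi : rformula V) :
  Prop := ~ occurs phi u.

Definition k_avoidable (V : Type) (k : nat) (phi : rformula V) : Prop :=
  infinite_set [set u : seq 'I_k | avoids u phi]%classic.

Inductive variable : Type := X | Y1 | Y2.

Definition phi2 : rformula variable :=
  [:: [:: inl X; inl Y1; inl Y2; inl X]; [:: inr Y1]; [:: inr Y2]].

(* Main.v *)
(** Let [t] be the Thue-Morse word and [s_n = 2 + t_(n+1) - t_n], a square-free
    word over {1, 2, 3}.  The word that avoids the formula is
      0^(s_0) 1^(s_0) 2^(s_0) 3^(s_0) 4^(s_0) 0^(s_1) 1^(s_1) ... ,
    whose [k]-th run has letter [k mod 5] and length [s_(k div 5)].  Since the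
    runs follow each other in the cyclic order of the letters, a factor whose
    reversal is also a factor lies in a single run.  So in an occurrence
    [x y1 y2 x] the part [y1 y2] meets at most two runs, and the second [x]
    starts [5 q] runs after the first one, with [q > 0] because runs have length
    at most 3.  Then [x] meets at least [5 q - 2] runs; all but the first and the
    last of these have the same length as the run [5 q] places further, and
    reading these lengths in one residue class modulo 5 gives a square in [s]. *)
Require Import Defs.
From mathcomp Require Import all_boot.
From mathcomp Require Import zify.
From mathcomp Require Import classical_sets cardinality.
Set Implicit Arguments.
Unset Strict Implicit.
Unset Printing Implicit Defensive.

(** * The Thue-Morse word *)

Fixpoint digit_parity d n :=
  if d is d'.+1 then odd n (+) digit_parity d' n./2 else false.

Definition thue_morse n := digit_parity n n.

Lemma digit_parity_fuel d n : n <= d -> digit_parity d n = thue_morse n.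
Proof.
have dp0 k : digit_parity k 0 = false by elim: k.
rewrite /thue_morse.
elim/ltn_ind: n d => -[|n] IH [|d] //= led.
by congr (_ (+) _); rewrite !(IH (uphalf n)) //; lia.
Qed.

Lemma thue_morse_rec n : thue_morse n = odd n (+) thue_morse n./2.
Proof. by rewrite -(@digit_parity_fuel n.+1 n) //= digit_parity_fuel //; lia. Qed.

Lemma thue_morse_double n : thue_morse n.*2 = thue_morse n.
Proof. by rewrite thue_morse_rec odd_double doubleK. Qed.

Lemma thue_morse_doubleS n : thue_morse n.*2.+1 = ~~ thue_morse n.
Proof. by rewrite thue_morse_rec /= odd_double uphalf_double. Qed.

Lemma thue_morse_even n : ~~ odd n -> thue_morse n.+1 = ~~ thue_morse n.
Proof.
move=> evn; rewrite -(even_halfK evn).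
by rewrite thue_morse_double thue_morse_doubleS.
Qed.

Lemma thue_morse_overlap_free p i : 0 < p ->
  ~ forall j, j <= p -> thue_morse (i + j + p) = thue_morse (i + j).
Proof.
elim/ltn_ind: p i => p IH i p0 ovl.
have [oddp|evp] := boolP (odd p).
  (* One of [k], [k + p] is even, so the window of length [p + 1] alternates;
     this contradicts the equality of its two ends. *)
  have alt j : j <= p -> thue_morse (i + j) = odd j (+) thue_morse i.
    elim: j => [|j IHj] lejp; first by rewrite addn0.
    have <- : ~~ thue_morse (i + j) = odd j.+1 (+) thue_morse i.
      by rewrite IHj ?(ltnW lejp) //= addNb.
    have [odk|evk] := boolP (odd (i + j)); last first.
      by rewrite addnS thue_morse_even.
    rewrite -(ovl _ lejp) -(ovl _ (ltnW lejp)) addnS addSn thue_morse_even //.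
    by rewrite oddD odk oddp.
  have := ovl 0 (leq0n p); rewrite addn0 alt // oddp.
  by case: (thue_morse i).
(* For even [p], the equalities at even [j] halve to an overlap of period [p./2] at [i./2]. *)
have hp : p = p./2.*2 by rewrite even_halfK.
apply: (IH p./2 _ i./2); [lia | lia | move=> j lej].
have := ovl j.*2 ltac:(lia).
have -> : i + j.*2 = odd i + (i./2 + j).*2 by lia.
have -> : odd i + (i./2 + j).*2 + p = odd i + (i./2 + j + p./2).*2 by lia.
case: (odd i); rewrite ?add0n ?add1n ?thue_morse_double //.
by rewrite !thue_morse_doubleS => /negb_inj.
Qed.

(** The [2] keeps the truncated subtraction exact and the values positive, so that they can be run
    lengths. *)
Definition ternary n := 2 + thue_morse n.+1 - thue_morse n.

Lemma ternary_bounds n : 0 < ternary n <= 3.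
Proof. by rewrite /ternary; case: thue_morse; case: thue_morse. Qed.

Lemma ternary_squarefree q i : 0 < q ->
  ~ forall j, j < q -> ternary (i + j + q) = ternary (i + j).
Proof.
move=> q0 sq.
(* Telescoping, with both sides moved so that no subtraction occurs. *)
have tel j : j <= q -> thue_morse (i + j + q) + thue_morse i
                     = thue_morse (i + j) + thue_morse (i + q) :> nat.
  elim: j => [|j IHj] lejq; first by rewrite addn0 addnC.
  have := sq j lejq; have := IHj (ltnW lejq).
  rewrite /ternary addnS addSn.
  by do 6!case: thue_morse.
apply: (@thue_morse_overlap_free q i q0) => j lejq.
(* At [j = q] this makes t_(i+q) - t_i and t_(i+2q) - t_(i+q) equal; for bits both must then vanish,
   hence so does the difference at every [j]. *)
have := tel j lejq; have := tel q (leqnn q).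
by do 5!case: thue_morse.
Qed.

(** * Words given by their run lengths *)

Definition run_start (l : nat -> nat) r := \sum_(k < r) l k.

Fixpoint run_index (l : nat -> nat) n :=
  if n is m.+1 then
    let r := run_index l m in if run_start l r.+1 <= m.+1 then r.+1 else r
  else 0.

Lemma run_startS l r : run_start l r.+1 = run_start l r + l r.
Proof. by rewrite /run_start big_ord_recr. Qed.

Lemma run_start_mono l r s : r <= s -> run_start l r <= run_start l s.
Proof.
move=> /subnK <-; elim: (s - r) => [|d IH] //.
by rewrite addSn run_startS (leq_trans IH) ?leq_addr.
Qed.

Lemma run_index_step l n :
  run_index l n.+1 = run_index l n \/ run_index l n.+1 = (run_index l n).+1.
Proof. by rewrite /=; case: ifP; [right | left]. Qed.

Lemma run_index_mono l m n : m <= n -> run_index l m <= run_index l n.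
Proof.
move=> /subnK <-; elim: (n - m) => [|d IH] //.
by rewrite addSn (leq_trans IH) //; case: (run_index_step l (d + m)) => ->.
Qed.

Section RunPositions.

Variable l : nat -> nat.
Hypothesis l_gt0 : forall k, 0 < l k.

Lemma run_indexP n :
  run_start l (run_index l n) <= n < run_start l (run_index l n).+1.
Proof.
elim: n => [|n /andP[IH1 IH2]] /=.
  by rewrite run_startS /run_start big_ord0 add0n l_gt0.
case: ifP => [le | /negbT]; last first.
  by rewrite -ltnNge => ->; rewrite (leq_trans IH1).
rewrite le [run_start l _.+2]run_startS.
by have := l_gt0 (run_index l n).+1; lia.
Qed.

Lemma run_index_jump n :
  run_index l n.+1 = (run_index l n).+1 -> run_start l (run_index l n.+1) = n.+1.
Proof.
move=> jump; have /andP[_ lt] := run_indexP n.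
by have /andP[le _] := run_indexP n.+1; rewrite jump in le *; lia.
Qed.

(** Discrete intermediate values: the index grows by at most one per position, so it cannot skip
    [k]. *)
Lemma run_start_between a b k : run_index l a < k <= run_index l b ->
  exists n, [/\ a <= n < b, run_start l k = n.+1, run_index l n = k.-1
              & run_index l n.+1 = k].
Proof.
elim: b => [|b IH] /andP[ak kb].
  by have := leq_trans ak kb; rewrite ltnNge run_index_mono.
have [kb'|bk] := leqP k (run_index l b).
  have [|n [/andP[an nb] st en en1]] := IH; first by rewrite ak kb'.
  by exists n; split=> //; rewrite an ltnW.
have ek : run_index l b.+1 = k by have := run_index_step l b; lia.
exists b; split=> //.
- rewrite ltnSn andbT leqNgt; apply/negP => ba.
  by have := run_index_mono l ba; rewrite ek; lia.
- by rewrite -ek run_index_jump //; have := run_index_step l b; lia.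
- by have := run_index_step l b; lia.
Qed.

(* [D] is the number of runs between two occurrences, at [i] and [i + p], of a
   word of length [m]. *)
Lemma run_length_shift i p m D k :
  (forall j, j < m -> run_index l (i + p + j) = run_index l (i + j) + D) ->
  0 < m -> run_index l i < k -> k < run_index l (i + m.-1) ->
  l (k + D) = l k.
Proof.
move=> shift m0 ik km.
(* A run starts where the index jumps, and the shift by [p] preserves jumps. The length of run [k]
   is a difference of two such starts. *)
have start k' : run_index l i < k' <= run_index l (i + m.-1) ->
    run_start l (k' + D) = run_start l k' + p.
  move=> /[dup] /andP[ik' _] /run_start_between [n [/andP[an nb] -> en en1]].
  have := shift (n - i) ltac:(lia); have := shift (n.+1 - i) ltac:(lia).
  have -> : i + p + (n.+1 - i) = (n + p).+1 by lia.
  have -> : i + p + (n - i) = n + p by lia.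
  rewrite !subnKC ?en ?en1; try lia.
  move=> e1 e0; rewrite -e1 run_index_jump; lia.
have := start k ltac:(lia); have := start k.+1 ltac:(lia).
by rewrite addSn !run_startS; lia.
Qed.

End RunPositions.

(** * The avoiding word *)

Definition run_length k := ternary (k %/ 5).

Definition run n := run_index run_length n.

Definition letter n : 'I_5 := inord (run n %% 5).

Lemma run_length_gt0 k : 0 < run_length k.
Proof. by case/andP: (ternary_bounds (k %/ 5)). Qed.

Lemma run_length_le3 k : run_length k <= 3.
Proof. by case/andP: (ternary_bounds (k %/ 5)). Qed.

Lemma run_add3 n : run n < run (n + 3).
Proof.
rewrite ltnNge; apply/negP => le3.
have := run_start_mono run_length (le3 : _.+1 <= _.+1).
have /andP[+ _] := run_indexP run_length_gt0 n.
have /andP[_] := run_indexP run_length_gt0 (n + 3).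
rewrite -!/(run _) (run_startS _ (run n)).
by have := run_length_le3 (run n); lia.
Qed.

Lemma letter_eq m n : letter m = letter n -> run m = run n %[mod 5].
Proof.
by move=> /(congr1 val); rewrite /= !inordK ?ltn_pmod.
Qed.

Definition factor_at (z : seq 'I_5) i :=
  forall j, j < size z -> nth ord0 z j = letter (i + j).

Lemma factor_at_cat u v i :
  factor_at (u ++ v) i -> factor_at u i /\ factor_at v (i + size u).
Proof.
move=> fuv; split=> j lt.
  by rewrite -fuv ?size_cat ?ltn_addr // nth_cat lt.
rewrite -addnA -fuv ?size_cat ?ltn_add2l // nth_cat ltnNge leq_addr /=.
by rewrite addKn.
Qed.

Lemma infix_factor_at z N : infix z (mkseq letter N) -> exists i, factor_at z i.
Proof.
move=> /infixP[a [b e]]; exists (size a) => j lt.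
have szN : N = size a + (size z + size b).
  by rewrite -(size_mkseq letter N) e !size_cat.
rewrite -(@nth_mkseq _ ord0 letter N) ?e; last by rewrite szN ltn_add2l ltn_addr.
by rewrite nth_cat ltnNge leq_addr /= addKn nth_cat lt.
Qed.

Lemma run_step n : run n.+1 = run n \/ run n.+1 = (run n).+1.
Proof. exact: run_index_step. Qed.

(** A change of run inside [y] would be read in [rev y] as a step of -1 modulo 5, but steps are 0 or
    1. *)
Lemma reversible_in_run y i i' : factor_at y i -> factor_at (rev y) i' ->
  forall j, j < size y -> run (i + j) = run i.
Proof.
move=> fy fr; elim=> [|j IHj] lt; first by rewrite addn0.
rewrite -IHj ?(ltnW lt) //.
have := fy _ lt; have := fy _ (ltnW lt).
have := fr (size y - j.+2); have := fr (size y - j.+2).+1.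
rewrite size_rev => /(_ ltac:(lia)) r1 /(_ ltac:(lia)) r0.
rewrite nth_rev in r1; last by lia.
rewrite nth_rev in r0; last by lia.
have e1 : size y - (size y - j.+2).+2 = j by lia.
have e0 : size y - (size y - j.+2).+1 = j.+1 by lia.
rewrite e1 in r1; rewrite e0 in r0; rewrite r1 r0 => /letter_eq + /letter_eq.
rewrite !addnS; have := run_step (i + j).
have := run_step (i' + (size y - j.+2)).
lia.
Qed.

(** Steps of [run] are 0 or 1, so the letters modulo 5 determine them. *)
Lemma run_shift x i i' : run i <= run i' -> factor_at x i -> factor_at x i' ->
  forall j, j < size x -> run (i' + j) = run (i + j) + (run i' - run i).
Proof.
move=> le fx fx'; elim=> [|j IHj] lt; first by rewrite !addn0 subnKC.
have := IHj (ltnW lt); have := fx' _ lt; have := fx' _ (ltnW lt).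
rewrite !fx ?(ltnW lt) // => /letter_eq + /letter_eq.
rewrite !addnS; have := run_step (i + j); have := run_step (i' + j).
lia.
Qed.

Lemma no_occurrence (x y1 y2 : seq 'I_5) i i1 i2 :
  0 < size x -> 0 < size y1 -> 0 < size y2 ->
  factor_at (rev y1) i1 -> factor_at (rev y2) i2 ->
  ~ factor_at (x ++ y1 ++ y2 ++ x) i.
Proof.
move=> nx ny1 ny2 fr1 fr2.
move=> /factor_at_cat[fx /factor_at_cat[fy1 /factor_at_cat[fy2 fx']]].
move: fy1 fy2 fx'; move ea: (i + size x) => a fy1.
move eb: (a + size y1) => b fy2; move ec: (b + size y2) => c fx'.
have leic : run i <= run c by apply: run_index_mono; lia.
have c1 : run b.-1 = run a.
  by rewrite -(reversible_in_run fy1 fr1 (j := (size y1).-1)); [congr run|]; lia.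
have c2 : run c.-1 = run b.
  by rewrite -(reversible_in_run fy2 fr2 (j := (size y2).-1)); [congr run|]; lia.
(* The run can change only on entering [y1], [y2] and the second [x]. *)
have lec : run c <= run (i + (size x).-1) + 3.
  have := run_step (i + (size x).-1); have := run_step b.-1.
  have := run_step c.-1.
  have -> : (i + (size x).-1).+1 = a by lia.
  have -> : b.-1.+1 = b by lia.
  have -> : c.-1.+1 = c by lia.
  lia.
have ltic : run i < run c.
  by apply: leq_trans (run_add3 i) _; apply: run_index_mono; lia.
have modD : run c = run i %[mod 5].
  by apply: letter_eq; rewrite -[c]addn0 -[i]addn0 -fx -?fx'.
pose q := (run c - run i) %/ 5.
have defD : run c = run i + 5 * q by lia.
have shift := run_shift leic fx fx'.
(* The runs [(run i).+1 + 5 * j] with [j < q] are interior to [x]: the last is [run i + 5 * q - 4],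
   and by [lec] the word [x] ends in run [run i + 5 * q - 3] or later. *)
apply: (@ternary_squarefree q ((run i).+1 %/ 5)); first by lia.
move=> j ltj.
have := @run_length_shift _ run_length_gt0 i (c - i) (size x) (run c - run i)
          ((run i).+1 + 5 * j).
rewrite subnKC; last by lia.
move=> /(_ shift ltac:(lia) ltac:(rewrite -/(run _); lia)).
move=> /(_ ltac:(rewrite -/(run _); lia)).
rewrite /run_length.
have -> : ((run i).+1 + 5 * j + (run c - run i)) %/ 5 = (run i).+1 %/ 5 + j + q.
  by lia.
by have -> : ((run i).+1 + 5 * j) %/ 5 = (run i).+1 %/ 5 + j by lia.
Qed.

Lemma avoiding_prefix N : avoids (mkseq letter N) phi2.
Proof.
move=> [h [[_ hM] hne hrev hin]].
have size_gt0 v : 0 < size (h [:: v]).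
  by rewrite lt0n size_eq0; apply/eqP/hne.
have := hin _ (or_introl erefl).
have := hin _ (or_intror (or_introl erefl)).
have := hin _ (or_intror (or_intror (or_introl erefl))).
rewrite (hM [:: inl X] _) (hM [:: inl Y1] _) (hM [:: inl Y2] _) !hrev.
move=> /infix_factor_at[i2 fr2] /infix_factor_at[i1 fr1].
by move=> /infix_factor_at[i]; apply: no_occurrence fr1 fr2.
Qed.

Theorem theorem2p4 : k_avoidable 5 phi2.
Proof.
(* Avoiding words exist in every length, so [size] would map a finite set onto all of [nat]. *)
move=> fin; apply: infinite_nat.
apply: sub_finite_set (finite_image size fin) => N _.
by exists (mkseq letter N); [exact: avoiding_prefix | exact: size_mkseq].
Qed.
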